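(* Let $0<\alpha<1$, $b\in\mathbb{R}$, and let $(\boldsymbol{x},\boldsymbol{y})\in\mathcal{X}$ be a feasible solution of the robust problem, i.e. $\boldsymbol{z}^\top\boldsymbol{x}\le b$ for all $\boldsymbol{z}\in\mathbb{R}^n$ with $\boldsymbol{h}(\boldsymbol{z})\in\mathcal{E}^\alpha(\boldsymbol{y})$. Suppose the warped Gaussian process models the uncertain function $g$, i.e. the random vector $[h(g(\boldsymbol{y}_1)),\ldots,h(g(\boldsymbol{y}_n))]^\top$ is distributed as $\mathcal{N}(\boldsymbol{\mu}(\boldsymbol{y}),\Sigma(\boldsymbol{y}))$. Then $$P\left(\sum_{i=1}^n g(\boldsymbol{y}_i)\,x_i\le b\right)\ge 1-\alpha .$$
   Context: $\mathcal{X}$ is a given set of pairs $(\boldsymbol{x},\boldsymbol{y})$ with $\boldsymbol{x}\in\mathbb{R}^n$ and $\boldsymbol{y}=(\boldsymbol{y}_1,\ldots,\boldsymbol{y}_n)$, $\boldsymbol{y}_i\in\mathbb{R}^k$. The warping function $h:\mathbb{R}\to\mathbb{R}$ is a strictly increasing bijection, and $\boldsymbol{h}(\boldsymbol{z})=[h(z_1),\ldots,h(z_n)]^\top$. The uncertain function $g:\mathbb{R}^k\to\mathbb{R}$ is modeled as random. $\boldsymbol{\mu}(\boldsymbol{y})\in\mathbb{R}^n$ and $\Sigma(\boldsymbol{y})\in\mathbb{R}^{n\times n}$ (symmetric positive definite) are the mean and covariance matrix predicted by the latent Gaussian process at $\boldsymbol{y}_1,\ldots,\boldsymbol{y}_n$.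 The $\alpha$-confidence ellipsoid in the latent space is $$\mathcal{E}^\alpha(\boldsymbol{y})=\{\boldsymbol{\xi}\in\mathbb{R}^n:(\boldsymbol{\xi}-\boldsymbol{\mu}(\boldsymbol{y}))^\top\Sigma^{-1}(\boldsymbol{y})(\boldsymbol{\xi}-\boldsymbol{\mu}(\boldsymbol{y}))\le F_n^{1-\alpha}\},$$ where $F_n^{1-\alpha}$ is the $(1-\alpha)$-quantile of the $\chi^2$ distribution with $n$ degrees of freedom. *)

(* Defs.v *)
From HB Require Import structures.
From mathcomp Require Import all_boot all_order all_algebra.
From mathcomp Require Import all_classical all_reals all_analysis.

Set Implicit Arguments.
Unset Strict Implicit.
Unset Printing Implicit Defensive.

Import Order.TTheory GRing.Theory Num.Theory.
Import numFieldNormedType.Exports.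

Local Open Scope classical_set_scope.
Local Open Scope ring_scope.

Section cons_measure.
Local Open Scope ereal_scope.
Context d (T : measurableType d) (R : realType) (n : nat).
Context (m1 : {sigma_finite_measure set T -> \bar R}).
Context (m2 : {sigma_finite_measure set (n.-tuple T) -> \bar R}).

(* The product measure [m1 \x m2], carried along the bijection
   (x, t) |-> x :: t from T * T^n to T^(n+1). *)
Definition cons_measure : set (n.+1.-tuple T) -> \bar R :=
  pushforward (m1 \x m2) (fun p => [tuple of p.1 :: p.2]).

Let measurable_cons_pair : measurable_fun [set: T * n.-tuple T]
  (fun p => [tuple of p.1 :: p.2] : n.+1.-tuple T).
Proof. exact: measurable_cons. Qed.

Let cons_measure0 : cons_measure set0 = 0.
Proof. by rewrite /cons_measure /pushforward preimage_set0 measure0. Qed.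

Let cons_measure_ge0 A : 0 <= cons_measure A.
Proof. exact: measure_ge0. Qed.

Let cons_measure_sigma_additive : semi_sigma_additive cons_measure.
Proof.
move=> F mF tF mUF; rewrite /cons_measure /pushforward preimage_bigcup.
apply: measure_semi_sigma_additive.
- by move=> i; rewrite -[X in measurable X]setTI; exact: measurable_cons_pair.
- apply/trivIsetP => /= i j _ _ ij; rewrite -preimage_setI.
  by move/trivIsetP : tF => /(_ _ _ _ _ ij) ->//; rewrite preimage_set0.
- rewrite -preimage_bigcup -[X in measurable X]setTI.
  exact: measurable_cons_pair.
Qed.

HB.instance Definition _ := isMeasure.Build _ _ _ cons_measure
  cons_measure0 cons_measure_ge0 cons_measure_sigma_additive.

Let cons_measure_sigma_finite : sigma_finite setT cons_measure.
Proof.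
have /sigma_finiteP[F [TF ndF Foo]] := sigma_finiteT m1.
have /sigma_finiteP[G [TG ndG Goo]] := sigma_finiteT m2.
exists (fun i => [set t | F i (thead t) /\ G i [tuple of behead t]]).
  apply/esym/seteqP; split=> // t _.
  have [i _ Fi] : (\bigcup_i F i) (thead t) by rewrite -TF.
  have [j _ Gj] : (\bigcup_i G i) [tuple of behead t] by rewrite -TG.
  exists (maxn i j) => //; split.
    by move: Fi; apply/subsetPset/ndF/leq_maxl.
  by move: Gj; apply/subsetPset/ndG/leq_maxr.
move=> i; have [mF Fi] := Foo i; have [mG Gi] := Goo i; split.
  rewrite [X in measurable X](_ : _ =
      ((fun t : n.+1.-tuple T => tnth t ord0) @^-1` F i) `&`
      ((fun t : n.+1.-tuple T => [tuple of behead t]) @^-1` G i))//.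
  apply: measurableI; rewrite -[X in measurable X]setTI.
    exact: measurable_tnth.
  exact: measurable_behead.
rewrite /cons_measure /pushforward [X in (_ \x _) X](_ : _ = F i `*` G i).
  by rewrite product_measure1E// lte_mul_pinfty// ge0_fin_numE.
have beheadK (x : T) (t : n.-tuple T) : [tuple of behead [tuple of x :: t]] = t.
  exact: val_inj.
by apply/seteqP; split=> -[x t] /=; rewrite theadE beheadK.
Qed.

HB.instance Definition _ := Measure_isSigmaFinite.Build _ _ _ cons_measure
  cons_measure_sigma_finite.

End cons_measure.

(* The n-fold product measure m \x ... \x m on T^n. *)
Fixpoint power_measure d (T : measurableType d) (R : realType)
    (m : {sigma_finite_measure set T -> \bar R}) (n : nat) :
    {sigma_finite_measure set (n.-tuple T) -> \bar R} :=
  if n is n'.+1 then cons_measure m (power_measure m n')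
  else \d_([tuple] : 0.-tuple T).

Definition lebesgue_measure_tuple (R : realType) (n : nat) :
    {sigma_finite_measure set (n.-tuple (measurableTypeR R)) -> \bar R} :=
  power_measure (@lebesgue_measure R) n.

(* The law of Z_1^2 + ... + Z_n^2 for Z_1, ..., Z_n independent and standard
   normal, i.e. (Z_1, ..., Z_n) has the n-fold product law. *)
Definition chi_squared (R : realType) (n : nat) : set R -> \bar R :=
  pushforward (power_measure (normal_prob (0 : R) 1) n)
    (fun z : n.-tuple (measurableTypeR R) => \sum_(i < n) tnth z i ^+ 2).

(* The least t such that nu `]-oo, t] >= p; this is the usual quantile when nu
   is a probability and 0 < p < 1 (otherwise inf takes a junk value). *)
Definition quantile (R : realType) (nu : set R -> \bar R) (p : R) : R :=
  inf [set t : R | (p%:E <= nu `]-oo, t]%classic)%E].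

Definition posdefmx (R : realType) (n : nat) (S : 'M[R]_n) : Prop :=
  S^T = S /\ forall v : 'cV[R]_n, v != 0 -> 0 < (v^T *m S *m v) 0 0.

Definition mahalanobis2 (R : realType) (n : nat) (m : 'cV[R]_n) (S : 'M[R]_n)
    (v : 'cV[R]_n) : R :=
  ((v - m)^T *m invmx S *m (v - m)) 0 0.

Definition multinormal_pdf (R : realType) (n : nat) (m : 'cV[R]_n)
    (S : 'M[R]_n) (v : 'cV[R]_n) : R :=
  (Num.sqrt ((2 * pi) ^+ n * \det S))^-1 * expR (- (mahalanobis2 m S v / 2)).

(* X is a random vector with law N(m, S), for S positive definite. R^n gets its
   Borel sets from the sigma-algebra on n-tuples generated by the coordinates,
   whence the passage between tuples and column vectors. *)
Definition multinormal (R : realType) (n : nat) d (Omega : measurableType d)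
    (P : probability Omega R) (X : Omega -> 'cV[R]_n) (m : 'cV[R]_n)
    (S : 'M[R]_n) : Prop :=
  let Xt w : n.-tuple (measurableTypeR R) := [tuple X w i 0 | i < n] in
  measurable_fun [set: Omega] Xt /\
  forall B : set (n.-tuple (measurableTypeR R)), measurable B ->
    P (Xt @^-1` B) =
    (\int[lebesgue_measure_tuple R n]_(t in B)
       (multinormal_pdf m S (\col_i tnth t i))%:E)%E.

Definition confidence_ellipsoid (R : realType) (n : nat) (alpha : R)
    (m : 'cV[R]_n) (S : 'M[R]_n) : set 'cV[R]_n :=
  [set xi | mahalanobis2 m S xi <= quantile (@chi_squared R n) (1 - alpha)].

(* Points y = (y_1, ..., y_n) of (R^k)^n are functions 'I_n -> 'cV_k. *)
Definition robust_feasible (R : realType) (n k : nat)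
    (XX : set ('cV[R]_n * ('I_n -> 'cV[R]_k))) (h : R -> R)
    (mu : ('I_n -> 'cV[R]_k) -> 'cV[R]_n)
    (Sigma : ('I_n -> 'cV[R]_k) -> 'M[R]_n) (alpha b : R)
    (x : 'cV[R]_n) (y : 'I_n -> 'cV[R]_k) : Prop :=
  XX (x, y) /\
  forall z : 'cV[R]_n,
    confidence_ellipsoid alpha (mu y) (Sigma y) (map_mx h z) ->
    (z^T *m x) 0 0 <= b.

(* Main.v *)
From HB Require Import structures.
Require Import Defs.
From mathcomp Require Import all_boot all_order all_algebra.
From mathcomp Require Import all_classical all_reals all_analysis.
From mathcomp Require Import measurable_realfun ring.

(** If X is a normal vector with mean m and covariance S, its squared
Mahalanobis distance to m has the chi-squared law with n degrees of freedom
([multinormal_mahalanobis2]). So, with X the vector of the warped values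
h (g (y_i)), the event that X falls in the alpha-confidence ellipsoid has
probability chi2 ]-oo, q], where q is the (1 - alpha)-quantile, and this is at
least 1 - alpha because a distribution function is right-continuous
([le_cdf_quantile]). On that event, robust feasibility applied to
z_i = g (y_i) gives the inequality with bound b; monotonicity of the
probability concludes.

The law of the Mahalanobis distance is computed without a multivariate change
of variables. All that is needed is the identity
  int f ((t - m)^T A (t - m)) dt = (det A)^(-1/2) int f (|t|^2) dt
for A positive definite and f >= 0 measurable ([ge0_integral_quadform]). It is
proved by induction on the dimension: completing the square in the first
coordinate splits the quadratic form into
(sqrt a * t_0 + c (t'))^2 + q (t'), where a is the pivot of A and q is the form
of its Schur complement. With t' fixed, a one-dimensional affine substitution
in t_0 removes a and c; Tonelli exchanges the two integrals and the induction
hypothesis applies to q. Taking A = S^-1 and for f a Gaussian weight restricted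
to a Borel set of values turns the integral of the normal density into that of
the product of standard normal densities, which is the density of the n-fold
product of the standard normal law ([ge0_integral_power_density]). *)

Set Implicit Arguments.
Unset Strict Implicit.
Unset Printing Implicit Defensive.

Import Order.TTheory GRing.Theory Num.Theory.
Import numFieldNormedType.Exports.

Local Open Scope classical_set_scope.
Local Open Scope ring_scope.

(** * Integration against a measure with a density *)

Section density.
Context d (T : measurableType d) (R : realType).
Variables (mu nu : {measure set T -> \bar R}) (g : T -> R).
Hypothesis mg : measurable_fun [set: T] g.
Hypothesis g0 : forall x, 0 <= g x.
Hypothesis nuE : forall A, measurable A ->
  nu A = (\int[mu]_(x in A) (g x)%:E)%E.
Local Open Scope ereal_scope.
Import HBNNSimple.

Let mgE : measurable_fun [set: T] (EFin \o g).
Proof. exact/measurable_EFinP. Qed.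

Let integral_density_nnsfun (f : {nnsfun T >-> R}) :
  \int[nu]_x (f x)%:E = \int[mu]_x ((f x)%:E * (g x)%:E).
Proof.
under eq_integral do rewrite fimfunE -fsumEFin//.
rewrite ge0_integral_fsum//; last 2 first.
- by move=> y; exact/measurable_EFinP/measurable_funM.
- by move=> y x _; rewrite nnfun_muleindic_ge0.
have fgE x : (f x)%:E * (g x)%:E =
    \sum_(k \in range f) ((k * \1_(f @^-1` [set k]) x)%:E * (g x)%:E).
  rewrite [in LHS]fimfunE -fsumEFin// ge0_mule_fsuml// => k.
  by rewrite nnfun_muleindic_ge0.
under [RHS]eq_integral do rewrite fgE.
rewrite ge0_integral_fsum//; last 2 first.
- move=> y; apply: emeasurable_funM => //.
  exact/measurable_EFinP/measurable_funM.
- by move=> y x _; rewrite mule_ge0 ?nnfun_muleindic_ge0 ?lee_fin.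
apply: eq_fsbigr => k kf.
have mk : measurable (f @^-1` [set k]) by exact: measurable_sfunP.
rewrite integralZl_indic_nnsfun// integral_indic// setIT nuE//.
have k0 : (0 <= k)%R by move: kf; rewrite inE => -[x _ <-].
rewrite [in LHS]integral_mkcond -ge0_integralZl_EFin//.
- apply: eq_integral => x _.
  by rewrite EFinM -muleA epatch_indic /= [(g x)%:E * _]muleC.
- by move=> x _; apply: erestrict_ge0 => y _; rewrite lee_fin.
- by apply/(measurable_restrictT _ _).1 => //; exact: measurable_funTS.
Qed.

(** The nonnegative simple functions follow from the case of an indicator, which
is the hypothesis [nuE]; monotone convergence does the rest. *)
Lemma ge0_integral_density (f : T -> \bar R) :
  measurable_fun [set: T] f -> (forall x, 0 <= f x) ->
  \int[nu]_x f x = \int[mu]_x (f x * (g x)%:E).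
Proof.
move=> mf f0; pose f_ := nnsfun_approx measurableT mf.
have cvgf x : (f_ n x)%:E @[n --> \oo] --> f x.
  by apply: cvg_nnsfun_approx => // y _.
transitivity (limn (fun n => \int[nu]_x (f_ n x)%:E)).
  rewrite -monotone_convergence//.
  - by apply: eq_integral => x _; apply/esym/cvg_lim.
  - by move=> n; exact/measurable_EFinP.
  - by move=> n x _; rewrite lee_fin.
  - by move=> x _ m n mn; rewrite lee_fin; exact/lefP/nd_nnsfun_approx.
under eq_fun do rewrite integral_density_nnsfun.
rewrite -monotone_convergence//.
- apply: eq_integral => x _; apply/cvg_lim => //.
  by apply: cvgeZr.
- by move=> n; apply: emeasurable_funM => //; exact/measurable_EFinP.
- by move=> n x _; rewrite mule_ge0 ?lee_fin.
- move=> x _ m n mn; rewrite lee_wpmul2r ?lee_fin//.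
  exact/lefP/nd_nnsfun_approx.
Qed.

End density.

(** * Affine substitution on the line *)

Section affine.
Context (R : realType).
Local Open Scope ereal_scope.
Local Notation leb := (@lebesgue_measure R).

Let affine (a c : R) (u : measurableTypeR R) : measurableTypeR R := (a * u + c)%R.

Let measurable_affine a c : measurable_fun [set: measurableTypeR R] (affine a c).
Proof. by apply: measurable_funD => //; apply: measurable_funM. Qed.

(* Lebesgue measure is determined by its values on the intervals ]x, y], whose
   preimages under the affine map are intervals of length (y - x) / a. *)
Let scaled_pushforward_affine (a c : R) (a0 : (0 < a)%R) A : measurable A ->
  leb A = a%:E * pushforward leb (affine a c) A.
Proof.
move=> mA.
have -> // : leb A = mscale (NngNum (ltW a0)) (pushforward leb (affine a c)) A.
move=> mf; refine (lebesgue_measure_unique _ mA).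
move=> _ [[x y]] _ <-.
rewrite /= /mscale /= /pushforward.
rewrite (_ : _ @^-1` _ = `]((x - c) / a)%R, ((y - c) / a)%R]%classic); last first.
  apply/seteqP; split=> u /=; rewrite !in_itv/= /affine.
    by rewrite ltr_pdivrMr// ler_pdivlMr// ltrBlDr lerBrDr mulrC.
  by rewrite ltr_pdivrMr// ler_pdivlMr// ltrBlDr lerBrDr mulrC.
rewrite !lebesgue_measure_itv/= !lte_fin ltr_pM2r ?invr_gt0// ltrD2r.
case: ifPn => _; last by rewrite mule0.
rewrite -!EFinD -EFinM; congr EFin; field.
by rewrite gt_eqF.
Qed.

Lemma ge0_integral_affine (a c : R) (f : R -> \bar R) : (0 < a)%R ->
  measurable_fun [set: R] f -> (forall x, 0 <= f x) ->
  \int[leb]_u f (a * u + c)%R = (a^-1)%:E * \int[leb]_u f u.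
Proof.
move=> a0 mf f0.
have maff := @measurable_affine a c.
transitivity (\int[pushforward leb (affine a c)]_u f u).
  by rewrite ge0_integral_pushforward.
rewrite [in RHS](eq_measure_integral
  (mscale (NngNum (ltW a0)) (pushforward leb (affine a c)))); last first.
  by move=> A mA _; exact: scaled_pushforward_affine.
rewrite ge0_integral_mscale//= muleA -EFinM mulVf ?mul1e//.
by rewrite gt_eqF.
Qed.

End affine.

(** * Integration against powers of a measure *)

Section cons_integral.
Context d (T : measurableType d) (R : realType).
Local Open Scope ereal_scope.

Lemma ge0_integral_cons_measure n (m1 : {sigma_finite_measure set T -> \bar R})
    (m2 : {sigma_finite_measure set (n.-tuple T) -> \bar R})
    (F : n.+1.-tuple T -> \bar R) :
  measurable_fun [set: n.+1.-tuple T] F -> (forall t, 0 <= F t) ->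
  \int[cons_measure m1 m2]_t F t =
  \int[m1 \x m2]_p F [tuple of p.1 :: p.2].
Proof.
move=> mF F0.
have mcons : measurable_fun [set: T * n.-tuple T]
    (fun p => [tuple of p.1 :: p.2] : n.+1.-tuple T) by exact: measurable_cons.
rewrite (eq_measure_integral
  (pushforward (m1 \x m2) (fun p => [tuple of p.1 :: p.2]))) //.
by rewrite ge0_integral_pushforward.
Qed.

End cons_integral.

Section power_density.
Context d (T : measurableType d) (R : realType).
Variables (mu nu : {sigma_finite_measure set T -> \bar R}) (g : T -> R).
Hypothesis mg : measurable_fun [set: T] g.
Hypothesis g0 : forall x, 0 <= g x.
Hypothesis nuE : forall A, measurable A ->
  nu A = (\int[mu]_(x in A) (g x)%:E)%E.
Local Open Scope ereal_scope.

Let measurable_prod_tnth n : measurable_fun [set: n.-tuple T]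
  (fun t => (\prod_(i < n) g (tnth t i))%:E : \bar R).
Proof.
apply/measurable_EFinP; apply: measurable_prod => i _.
by apply: measurableT_comp => //; exact: measurable_tnth.
Qed.

(** If nu has density g with respect to mu, then its n-th power has the product
density: the density of the first coordinate is peeled off by Tonelli. *)
Lemma ge0_integral_power_density n (F : n.-tuple T -> \bar R) :
  measurable_fun [set: n.-tuple T] F -> (forall t, 0 <= F t) ->
  \int[power_measure nu n]_t F t =
  \int[power_measure mu n]_t (F t * (\prod_(i < n) g (tnth t i))%:E).
Proof.
elim: n F => [|n IH] F mF F0.
  by apply: eq_integral => t _; rewrite big_ord0 mule1.
have mcons : measurable_fun [set: T * n.-tuple T]
    (fun p => [tuple of p.1 :: p.2] : n.+1.-tuple T) by exact: measurable_cons.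
have mFcons : measurable_fun [set: T * n.-tuple T]
    (fun p => F [tuple of p.1 :: p.2]) by exact: measurableT_comp.
pose H t := F t * (\prod_(i < n.+1) g (tnth t i))%:E.
have mH : measurable_fun [set: n.+1.-tuple T] H.
  by apply: emeasurable_funM => //; exact: measurable_prod_tnth.
have H0 t : 0 <= H t by rewrite mule_ge0// lee_fin prodr_ge0.
rewrite -/(H _) /= ge0_integral_cons_measure// ge0_integral_cons_measure//.
rewrite fubini_tonelli1// fubini_tonelli1; last 2 first.
- exact: (measurableT_comp mH mcons).
- by move=> p; exact: H0.
rewrite (ge0_integral_density mg g0 nuE); last 2 first.
- exact: measurable_fun_fubini_tonelli_F.
- by move=> u; exact: integral_ge0.
apply: eq_integral => u _; rewrite /fubini_F /=.
have mFu : measurable_fun [set: n.-tuple T] (fun t => F [tuple of u :: t]).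
  by apply: measurableT_comp => //; exact: measurable_cons.
rewrite IH// muleC -ge0_integralZl_EFin//; last 2 first.
- by move=> t _; rewrite mule_ge0// lee_fin prodr_ge0.
- by apply: emeasurable_funM => //; exact: measurable_prod_tnth.
apply: eq_integral => t _.
rewrite /H big_ord_recl tnth0; under [in RHS]eq_bigr do rewrite tnthS.
by rewrite EFinM muleCA.
Qed.

End power_density.

(** * Positive definite matrices and the Schur complement *)

Section linear_algebra.
Context (R : realType).

Definition quadform n (A : 'M[R]_n) (v : 'cV[R]_n) : R := (v^T *m A *m v) 0 0.

Lemma posdefmx_unit n (S : 'M[R]_n) : posdefmx S -> S \in unitmx.
Proof.
move=> [_ Spos]; rewrite -row_free_unit -kermx_eq0.
apply/eqP/row_matrixP => i; rewrite row0.
set u := row i _; have uS : u *m S = 0 by rewrite -row_mul mulmx_ker row0.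
apply/eqP; apply: contraT => u0.
have := Spos u^T; rewrite trmx_eq0 trmxK uS mul0mx mxE ltxx.
by move=> /(_ u0).
Qed.

Lemma posdefmx_inv n (S : 'M[R]_n) : posdefmx S -> posdefmx (invmx S).
Proof.
move=> Spd; have Su := posdefmx_unit Spd; have [St Spos] := Spd.
have SVt : (invmx S)^T = invmx S by rewrite trmx_inv St.
split=> // v v0; have := Spos (invmx S *m v).
rewrite trmx_mul SVt -!mulmxA mulKVmx//; apply.
by apply: contra_neq v0 => /(congr1 (mulmx S)); rewrite mulKVmx// mulmx0.
Qed.

Section schur.
Variables (n : nat) (A : 'M[R]_(1 + n)).
Hypothesis Apd : posdefmx A.

Definition schur_complement : 'M[R]_n :=
  drsubmx A - (A 0 0)^-1 *: (dlsubmx A *m ursubmx A).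

Lemma posdefmx_pivot_gt0 : 0 < A 0 0.
Proof.
have := Apd.2 (delta_mx 0 0); rewrite trmx_delta -rowE -colE !mxE; apply.
by apply/eqP => /matrixP/(_ 0 0)/eqP; rewrite !mxE !eqxx oner_eq0.
Qed.

Let Ablock : A = block_mx (A 0 0)%:M (ursubmx A) (dlsubmx A) (drsubmx A).
Proof.
rewrite -[LHS]submxK; congr block_mx; apply/matrixP => i j.
by rewrite !ord1 !mxE eqxx mulr1n; congr (A _ _); exact: val_inj.
Qed.

Let dlsubmxE : dlsubmx A = (ursubmx A)^T.
Proof. by rewrite trmx_ursub Apd.1. Qed.

(** Completing the square in the first coordinate. *)
Lemma quadform_schur (u : R) (w : 'cV[R]_n) :
  quadform A (col_mx u%:M w) =
  A 0 0 * (u + (A 0 0)^-1 * (ursubmx A *m w) 0 0) ^+ 2 +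
  quadform schur_complement w.
Proof.
have a0 : A 0 0 != 0 by rewrite gt_eqF// posdefmx_pivot_gt0.
rewrite /quadform {1}Ablock tr_col_mx tr_scalar_mx mul_row_block mul_row_col.
rewrite mulmxDl -!scalar_mxM /schur_complement mulmxBr mulmxBl.
rewrite -scalemxAr -scalemxAl dlsubmxE !mulmxA.
have -> : w^T *m (ursubmx A)^T = (ursubmx A *m w)^T by rewrite trmx_mul.
rewrite mulmxDl -!mulmxA.
move: (ursubmx A *m w) (w^T *m (drsubmx A *m w)) => c D.
rewrite [c]mx11_scalar [D]mx11_scalar tr_scalar_mx -!scalar_mxM.
move: (c 0 0) (D 0 0) => {}c {}D.
rewrite !mxE !eqxx !mulr1n.
by field.
Qed.

(** One step of block Gaussian elimination. *)
Lemma det_schur : \det A = A 0 0 * \det schur_complement.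
Proof.
have a0 : A 0 0 != 0 by rewrite gt_eqF// posdefmx_pivot_gt0.
pose L : 'M[R]_(1 + n) := block_mx 1%:M 0 ((A 0 0)^-1 *: dlsubmx A) 1%:M.
have AE : A = L *m block_mx (A 0 0)%:M (ursubmx A) 0 schur_complement.
  rewrite [LHS]Ablock mulmx_block !mul1mx !mul0mx !addr0.
  rewrite mul_mx_scalar scalerA divff// scale1r -scalemxAl.
  by rewrite /schur_complement addrCA subrr addr0.
by rewrite {1}AE det_mulmx det_lblock det_ublock !det1 !mul1r det_scalar1.
Qed.

Lemma posdefmx_schur : posdefmx schur_complement.
Proof.
split=> [|w w0].
  rewrite /schur_complement linearB linearZ /= trmx_mul dlsubmxE trmxK.
  by rewrite trmx_drsub Apd.1.
(* This first coordinate cancels the square in [quadform_schur]. *)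
have := Apd.2 (col_mx (- ((A 0 0)^-1 * (ursubmx A *m w) 0 0))%:M w).
rewrite -/(quadform _ _) quadform_schur addNr expr0n mulr0 add0r; apply.
by apply: contra_neq w0 => /eqP; rewrite col_mx_eq0 => /andP[_ /eqP].
Qed.

End schur.

Lemma posdefmx_det_gt0 n (A : 'M[R]_n) : posdefmx A -> 0 < \det A.
Proof.
elim: n A => [|n IH] A Apd; first by rewrite det_mx00.
rewrite (@det_schur n A Apd) mulr_gt0 ?posdefmx_pivot_gt0//.
exact/IH/posdefmx_schur.
Qed.

End linear_algebra.
(** * Integrals of functions of a quadratic form *)

Section quadratic_change_of_variables.
Context (R : realType).
Local Notation RT := (measurableTypeR R).

Definition col_of_tuple n (t : n.-tuple RT) : 'cV[R]_n := \col_i tnth t i.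

Lemma col_of_tuple_cons n (u : RT) (t : n.-tuple RT) :
  col_of_tuple [tuple of u :: t] = col_mx (u : R)%:M (col_of_tuple t).
Proof.
apply/matrixP => i j; rewrite mxE ord1.
case: (unliftP ord0 i) => [k ->|->].
  rewrite tnthS (_ : lift ord0 k = rshift 1 k); last exact: val_inj.
  by rewrite (@col_mxEd _ 1) mxE.
rewrite tnth0 (_ : (ord0 : 'I_n.+1) = lshift n (ord0 : 'I_1)); last exact: val_inj.
by rewrite (@col_mxEu _ 1) mxE eqxx mulr1n.
Qed.

Lemma measurable_quadform n (A : 'M[R]_n) (m : 'cV[R]_n) :
  measurable_fun [set: n.-tuple RT]
    (fun t => quadform A (col_of_tuple t - m)).
Proof.
have mc (i : 'I_n) : measurable_fun [set: n.-tuple RT]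
    (fun t => (col_of_tuple t - m) i 0).
  under eq_fun do rewrite !mxE.
  by apply: measurable_funB => //; exact: measurable_tnth.
under eq_fun do rewrite /quadform mxE.
apply: measurable_sum => i; apply: measurable_funM => //.
under eq_fun do rewrite mxE.
apply: measurable_sum => j; apply: measurable_funM => //.
under eq_fun do rewrite mxE.
exact: mc.
Qed.

Lemma measurable_sum_sqr n :
  measurable_fun [set: n.-tuple RT] (fun t => \sum_(i < n) tnth t i ^+ 2 : R).
Proof.
apply: measurable_sum => i; apply: measurable_funX.
exact: measurable_tnth.
Qed.

Local Open Scope ereal_scope.

(** Special case of the linear change of variables, obtained by induction on the
dimension from the one-dimensional one: the pivot contributes its inverse square
root, the Schur complement the rest of the determinant. *)
Lemma ge0_integral_quadform n (A : 'M[R]_n) (m : 'cV[R]_n) (f : R -> \bar R) :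
  posdefmx A -> measurable_fun [set: R] f -> (forall x, 0 <= f x) ->
  \int[lebesgue_measure_tuple R n]_t f (quadform A (col_of_tuple t - m)%R) =
  ((Num.sqrt (\det A))^-1)%:E *
  \int[lebesgue_measure_tuple R n]_t f (\sum_(i < n) tnth t i ^+ 2)%R.
Proof.
elim: n A m f => [|n IH] A m f Apd mf f0.
  rewrite det_mx00 sqrtr1 invr1 mul1e; apply: eq_integral => t _.
  by rewrite big_ord0 /quadform mxE big_ord0.
pose a : R := A 0%R 0%R; have a0 : (0 < a)%R by exact: (@posdefmx_pivot_gt0 _ n).
have sa0 : (0 < Num.sqrt a)%R by rewrite sqrtr_gt0.
pose D : 'M[R]_n := schur_complement (A : 'M[R]_(1 + n)).
have Dpd : posdefmx D by exact: posdefmx_schur.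
pose m' : 'cV[R]_n := dsubmx (m : 'cV[R]_(1 + n)).
pose q t := quadform D (col_of_tuple t - m').
pose c t := (Num.sqrt a *
  (a^-1 * (ursubmx (A : 'M[R]_(1 + n)) *m (col_of_tuple t - m')) 0 0 - m 0 0))%R.
have quadE (u : RT) (t : n.-tuple RT) : quadform A (col_of_tuple [tuple of u :: t] - m)%R =
    ((Num.sqrt a * u + c t) ^+ 2 + q t)%R.
  have -> : (col_of_tuple [tuple of u :: t] - m =
      col_mx (u - m 0 0)%:M (col_of_tuple t - m'))%R.
    rewrite col_of_tuple_cons -[in LHS](@vsubmxK _ 1 n _ m).
    rewrite (@opp_col_mx _ 1 n) (@add_col_mx _ 1 n); apply: (f_equal2 (@col_mx _ 1 n 1)) => //.
    apply/matrixP => i j; rewrite !ord1 !mxE eqxx !mulr1n; congr (_ - m _ _)%R.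
    exact: val_inj.
  rewrite (@quadform_schur R n A Apd) -/D -/(q t); congr (_ + _)%R.
  rewrite -/a /c; move: (_ 0%R 0%R) (m 0%R 0%R) => b m0.
  have sa2 : (Num.sqrt a ^+ 2 = a)%R by rewrite sqr_sqrtr// ltW.
  by rewrite -[X in (X * _)%R = _]sa2; ring.
have mquad := measurable_quadform A m.
have mcons : measurable_fun [set: RT * n.-tuple RT]
    (fun p => [tuple of p.1 :: p.2] : n.+1.-tuple RT) by exact: measurable_cons.
have mfA : measurable_fun [set: n.+1.-tuple RT]
    (fun t => f (quadform A (col_of_tuple t - m)%R)).
  exact: measurableT_comp.
have mq : measurable_fun [set: n.-tuple RT] q by exact: measurable_quadform.
have mfs : measurable_fun [set: n.+1.-tuple RT]
    (fun t => f (\sum_(i < n.+1) tnth t i ^+ 2)%R).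
  by apply: measurableT_comp => //; exact: measurable_sum_sqr.
have msq : measurable_fun [set: RT] (fun u : RT => u ^+ 2 : R)%R.
  exact: measurable_funX.
have mfq : measurable_fun [set: RT * n.-tuple RT]
    (fun p => f (p.1 ^+ 2 + q p.2)%R).
  apply: measurableT_comp => //; apply: measurable_funD.
    exact: (measurableT_comp msq measurable_fst).
  exact: (measurableT_comp mq measurable_snd).
rewrite /lebesgue_measure_tuple /=.
rewrite ge0_integral_cons_measure// ge0_integral_cons_measure//.
(* The first coordinate is integrated first, since its shift c t depends on the
   others. *)
rewrite fubini_tonelli2//; last exact: (measurableT_comp mfA mcons).
transitivity (\int[power_measure (@lebesgue_measure R) n]_t
    (((Num.sqrt a)^-1)%:E * \int[@lebesgue_measure R]_u f (u ^+ 2 + q t)%R)).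
  apply: eq_integral => t _; rewrite /fubini_G /=.
  rewrite -(@ge0_integral_affine _ _ (c t) (fun u => f (u ^+ 2 + q t)%R))//.
    by apply: eq_integral => u _; rewrite quadE.
  apply: measurableT_comp => //; apply: measurable_funD => //.
rewrite ge0_integralZl_EFin//; last 2 first.
- by move=> t _; exact: integral_ge0.
- exact: (measurable_fun_fubini_tonelli_G _ mfq).
(* Exchanging the integrals lets the induction hypothesis be used with the first
   coordinate u fixed, for the function s |-> f (u ^ 2 + s). *)
rewrite -(fubini_tonelli (fun p : RT * n.-tuple RT => f (p.1 ^+ 2 + q p.2)%R))//.
rewrite fubini_tonelli1//; last exact: (measurableT_comp mfs mcons).
transitivity (((Num.sqrt a)^-1)%:E * \int[@lebesgue_measure R]_u
    (((Num.sqrt (\det D))^-1)%:E *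
     \int[power_measure (@lebesgue_measure R) n]_t
       f (u ^+ 2 + \sum_(i < n) tnth t i ^+ 2)%R)).
  congr *%E; apply: eq_integral => u _.
  rewrite -(IH _ m' (fun s => f (u ^+ 2 + s)%R))//.
  by apply: measurableT_comp => //; exact: measurable_funD.
have fsE (u : RT) (t : n.-tuple RT) : f (\sum_(i < n.+1) tnth [tuple of u :: t] i ^+ 2)%R =
    f (u ^+ 2 + \sum_(i < n) tnth t i ^+ 2)%R.
  rewrite big_ord_recl tnth0.
  by under [in LHS]eq_bigr do rewrite tnthS.
rewrite ge0_integralZl_EFin//; last 2 first.
- by move=> u _; exact: integral_ge0.
- apply: (measurable_fun_fubini_tonelli_F
    (fun p : RT * n.-tuple RT => f (p.1 ^+ 2 + \sum_i tnth p.2 i ^+ 2)%R)) => //.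
  apply: measurableT_comp => //; apply: measurable_funD.
    exact: (measurableT_comp msq measurable_fst).
  exact: (measurableT_comp (@measurable_sum_sqr n) measurable_snd).
rewrite muleA -EFinM -invfM -sqrtrM ?ltW// -(@det_schur R n A Apd).
congr *%E; apply: eq_integral => u _; rewrite /fubini_F.
by apply: eq_integral => t _; rewrite fsE.
Qed.

End quadratic_change_of_variables.

(** * Quantiles *)

Section quantile.
Context d (T : measurableType d) (R : realType) (P : probability T R).
Local Open Scope ereal_scope.

(** The infimum defining the quantile is attained: the distribution function is
at least p to the right of it, hence also at the infimum by
right-continuity. *)
Lemma le_cdf_quantile (X : {RV P >-> R}) (p : R) : (p < 1)%R ->
  p%:E <= cdf X (quantile (distribution P X) p).
Proof.
move=> p1; rewrite /quantile -/(cdf X).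
pose E := [set t : R | p%:E <= cdf X t].
rewrite -[X in inf X]/E.
have Eup s t : E s -> (s <= t)%R -> E t.
  by move=> Es st; apply: (le_trans Es); exact: cdf_nondecreasing.
have E0 : E !=set0.
  have : \forall t \near +oo%R, p%:E < cdf X t.
    apply: (@cvg_cdfy1 _ _ _ _ X [set e | p%:E < e]); apply: open_nbhs_nbhs.
    by split; [exact: open_ereal_gt_ereal|rewrite /= lte_fin].
  by move=> [M [_ ltM]]; exists (M + 1)%R; apply/ltW/ltM; rewrite ltrDl.
apply: cvge_ge (@cdf_right_continuous _ _ _ _ X (inf E)).
near=> t; have /(inf_lt E0)[s Es st] : (inf E < t)%R.
  by near: t; exact: nbhs_right_gt.
exact: (Eup _ _ Es (ltW st)).
Unshelve. all: by end_near. Qed.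

End quantile.

(** * The Mahalanobis distance of a normal vector *)

Section multinormal_mahalanobis2.
Context (R : realType) (n : nat).
Local Notation RT := (measurableTypeR R).

Lemma prod_normal_pdf (t : n.-tuple RT) :
  \prod_(i < n) normal_pdf 0 1 (tnth t i) =
  (Num.sqrt ((2 * pi) ^+ n))^-1 * expR (- ((\sum_(i < n) tnth t i ^+ 2) / 2)) :> R.
Proof.
under eq_bigr do rewrite normal_pdfE ?oner_eq0//.
rewrite big_split/= prodr_const card_ord; congr (_ * _).
  rewrite /normal_peak expr1n mul1r -mulr_natl.
  have : 0 <= 2 * pi :> R by rewrite mulr_ge0// pi_ge0.
  move: (2 * pi) => c c0; elim: n => [|k IH]; first by rewrite !expr0 sqrtr1 invr1.
  by rewrite exprS IH [in RHS]exprS sqrtrM ?invfM.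
rewrite mulr_suml -sumrN expR_sum; apply: eq_bigr => i _.
by rewrite /normal_fun expr1n subr0 mulNr.
Qed.

(** The density of X depends on X only through its Mahalanobis distance, so both
sides are integrals of a function of a quadratic form, and
[ge0_integral_quadform] for the inverse of S reduces the one to the other. *)
Lemma multinormal_mahalanobis2 d (Omega : measurableType d)
    (P : probability Omega R) (X : Omega -> 'cV[R]_n) (m : 'cV[R]_n)
    (S : 'M[R]_n) (A : set R) :
  posdefmx S -> multinormal P X m S -> measurable A ->
  P [set w | A (mahalanobis2 m S (X w))] = @chi_squared R n A.
Proof.
move=> Spd [_ PX] mA; have SVpd := posdefmx_inv Spd.
pose Q (t : n.-tuple RT) := quadform (invmx S) (col_of_tuple t - m).
pose N (t : n.-tuple RT) := \sum_(i < n) tnth t i ^+ 2 : R.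
pose K := (Num.sqrt ((2 * pi) ^+ n * \det S))^-1.
pose f (s : R) := (K * expR (- (s / 2)) * \1_A s)%:E.
have K0 : 0 <= K by rewrite invr_ge0 sqrtr_ge0.
have f0 s : (0 <= f s)%E by rewrite lee_fin !mulr_ge0 ?expR_ge0.
have mf : measurable_fun [set: R] f.
  apply/measurable_EFinP; apply: measurable_funM; last exact: measurable_indic.
  apply: measurable_funM => //; apply: measurableT_comp => //.
  by apply: measurableT_comp => //; exact: measurable_funM.
have mQ : measurable_fun [set: n.-tuple RT] Q by exact: measurable_quadform.
have mN : measurable_fun [set: n.-tuple RT] N by exact: measurable_sum_sqr.
have mQA : measurable (Q @^-1` A) by rewrite -[X in measurable X]setTI; exact: mQ.
have mNA : measurable (N @^-1` A) by rewrite -[X in measurable X]setTI; exact: mN.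
transitivity (P ((fun w => [tuple X w i 0 | i < n] : n.-tuple RT) @^-1`
    (Q @^-1` A))).
  congr (P _); apply/seteqP; split=> w /=; rewrite /Q /mahalanobis2 /quadform;
  (rewrite (_ : col_of_tuple _ = X w);
    last by apply/matrixP => i j; rewrite mxE tnth_mktuple ord1) => //.
rewrite PX// integral_mkcond.
transitivity (\int[lebesgue_measure_tuple R n]_t f (Q t))%E.
  by apply: eq_integral => t _; rewrite epatch_indic /= -EFinM.
rewrite ge0_integral_quadform// /chi_squared /pushforward -/N.
rewrite -[in RHS](setIT (N @^-1` A)) -integral_indic//.
rewrite (@ge0_integral_power_density _ _ _ (@lebesgue_measure R)
  (normal_prob 0 1) (normal_pdf 0 1))//; last 3 first.
- exact: measurable_normal_pdf.
- by move=> x; exact: normal_pdf_ge0.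
- exact/measurable_EFinP/measurable_indic.
rewrite -ge0_integralZl_EFin//; last first.
  by apply: measurableT_comp.
apply: eq_integral => t _; rewrite -!EFinM prod_normal_pdf -/(N t); congr EFin.
(* The factor sqrt (det S) from the change of variables cancels the one in the
   normalization constant of the density. *)
have detS := posdefmx_det_gt0 Spd.
rewrite /K det_inv sqrtrV ?ltW// invrK sqrtrM; last first.
  by rewrite exprn_ge0// mulr_ge0// pi_ge0.
have : Num.sqrt (\det S) != 0 by rewrite gt_eqF// sqrtr_gt0.
move: (Num.sqrt (\det S)) => s s0.
rewrite invfM.
transitivity (s / s * ((Num.sqrt ((2 * pi) ^+ n))^-1 * expR (- (N t / 2)) * \1_A (N t))).
  ring.
by rewrite divff// mul1r mulrC.
Qed.

End multinormal_mahalanobis2.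

(** * The probabilistic guarantee *)

Theorem mainTheorem1 (R : realType) (n k : nat)
    (XX : set ('cV[R]_n * ('I_n -> 'cV[R]_k)))
    (h : R -> R)
    (h_increasing : {homo h : s t / s < t}) (h_bijective : bijective h)
    (mu : ('I_n -> 'cV[R]_k) -> 'cV[R]_n)
    (Sigma : ('I_n -> 'cV[R]_k) -> 'M[R]_n)
    (d : measure_display) (Omega : measurableType d) (P : probability Omega R)
    (g : 'cV[R]_k -> {RV P >-> R})
    (alpha b : R) (alpha_gt0 : 0 < alpha) (alpha_lt1 : alpha < 1)
    (x : 'cV[R]_n) (y : 'I_n -> 'cV[R]_k)
    (Sigma_posdef : posdefmx (Sigma y))
    (xy_feasible : robust_feasible XX h mu Sigma alpha b x y)
    (g_model : multinormal P (fun w => \col_i h (g (y i) w)) (mu y) (Sigma y)) :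
  ((1 - alpha)%:E <= P [set w | (\sum_(i < n) g (y i) w * x i 0 <= b)%R])%E.
Proof.
pose D2 w := mahalanobis2 (mu y) (Sigma y) (\col_i h (g (y i) w)).
have mD2 : measurable_fun [set: Omega] D2.
  have [mX _] := g_model.
  apply: (eq_measurable_fun _ _
    (measurableT_comp (measurable_quadform (invmx (Sigma y)) (mu y)) mX)) => w _ /=.
  congr quadform; congr (_ - _); apply/matrixP => i j.
  by rewrite !mxE tnth_mktuple mxE.
(* As a random variable on Omega, the Mahalanobis distance has chi-squared
   distribution function, so [le_cdf_quantile] applies to it directly. *)
pose D2RV : {RV P >-> R} :=
  HB.pack D2 (isMeasurableFun.Build _ _ _ _ D2 mD2).
have cdfD2 t : cdf D2RV t = @chi_squared R n `]-oo, t].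
  by rewrite -(multinormal_mahalanobis2 Sigma_posdef g_model).
have qE : quantile (distribution P D2RV) (1 - alpha) =
    quantile (@chi_squared R n) (1 - alpha).
  rewrite /quantile; congr inf; apply/seteqP.
  by split=> t /=; rewrite -cdfD2.
have := @le_cdf_quantile _ _ _ _ D2RV (1 - alpha).
rewrite qE gtrBl => /(_ alpha_gt0).
move=> /le_trans; apply; rewrite /cdf /distribution /pushforward.
apply: le_measure; rewrite ?inE.
- by rewrite -[X in measurable X]setTI; exact: (measurable_funP D2RV).
- rewrite -[X in measurable X]setTI.
  rewrite [X in measurable (_ `&` X)](_ : _ =
    (fun w => \sum_(i < n) g (y i) w * x i 0) @^-1` `]-oo, b]%classic); last first.
    by apply/seteqP; split=> w /=; rewrite in_itv.
  suff : measurable_fun [set: Omega] (fun w => \sum_(i < n) g (y i) w * x i 0).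
    by apply.
  by apply: measurable_sum => i; exact: measurable_funM.
move=> w /=; rewrite in_itv/= => D2w.
have ellipsoid_w :
    confidence_ellipsoid alpha (mu y) (Sigma y) (map_mx h (\col_i g (y i) w)).
  rewrite /confidence_ellipsoid /=.
  suff -> : map_mx h (\col_i g (y i) w) = \col_i h (g (y i) w) by [].
  by apply/matrixP => i j; rewrite !mxE.
have := xy_feasible.2 _ ellipsoid_w; rewrite mxE.
by under [X in X <= b -> _]eq_bigr do rewrite !mxE.
Qed.
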